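(* Let $\mathcal Q_1$ be the unary query on unlabelled graphs defined by $\mathcal Q_1(G)=\{u\in V(G):\exists v\in N_G(u)\ \deg_G(u)<\deg_G(v)\}$. Then $\mathcal Q_1$ is computable by a 2-GNN all of whose layers use $\mathrm{SUM}$ aggregation, but it is not computable by any 1-GNN all of whose layers use $\mathrm{SUM}$ aggregation.
   Context: Graphs are finite, simple, undirected; $N_G(v)$ is the neighbourhood and $\deg_G(v)=|N_G(v)|$. An FNN is a composition of layers $\vec x\mapsto\sigma(A\vec x+\vec b)$ with rational weight matrix $A$ and bias $\vec b$, where $\sigma$ is either $\mathrm{ReLU}(x)=\max\{x,0\}$ or the identity, applied coordinatewise. An $\ell$-dimensional signal on $G$ is a map $\mathcal f:V(G)\to\mathbb R^\ell$. A 1-GNN layer of input dimension $p$ and output dimension $q$ is a triple $(\mathrm{msg},\mathrm{agg},\mathrm{comb})$ with $\mathrm{msg}:\mathbb R^p\to\mathbb R^r$ and $\mathrm{comb}:\mathbb R^{p+r}\to\mathbb R^q$ computed by FNNs and $\mathrm{agg}$ one of $\mathrm{SUM},\mathrm{MEAN},\mathrm{MAX}$ (applied coordinatewise to finite multisets of vectors, with value $\vec 0$ on the empty multiset); it maps $(G,\mathcal f)$ to $(G,\mathcal f')$ with $\mathcal f'(v)=\mathrm{comb}\big(\mathcal f(v),\mathrm{agg}(\{\!\{\mathrm{msg}(\mathcal f(w)):w\in N_G(v)\}\!\})\big)$. A 2-GNN layer is the same except $\mathrm{msg}:\mathbb R^{2p}\to\mathbb R^r$ and $\mathcal f'(v)=\mathrm{comb}\big(\mathcal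 f(v),\mathrm{agg}(\{\!\{\mathrm{msg}(\mathcal f(v),\mathcal f(w)):w\in N_G(v)\}\!\})\big)$. An $i$-GNN ($i=1,2$) is a finite sequence of $i$-GNN layers with matching dimensions, computing the composition of the layer maps; its output signal on $(G,\mathcal f)$ is denoted $S_{\mathfrak N}(G,\mathcal f)$. An unlabelled graph is given the $0$-dimensional input signal (every vertex mapped to the empty tuple). A GNN $\mathfrak N$ with output dimension $1$ computes a unary query $\mathcal Q$ if for every input graph $G$ and $v\in V(G)$: $S_{\mathfrak N}(G)(v)\ge 3/4$ if $v\in\mathcal Q(G)$ and $S_{\mathfrak N}(G)(v)\le 1/4$ otherwise. *)

(* Defs.v *)
From HB Require Import structures.
From mathcomp Require Import all_boot all_order all_algebra.
From mathcomp Require Import reals.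
Set Implicit Arguments.
Unset Strict Implicit.
Unset Printing Implicit Defensive.
Import Order.TTheory GRing.Theory Num.Theory.
Local Open Scope ring_scope.

Record sgraph := SGraph {
  vertex :> finType;
  adj : rel vertex;
  adj_sym : symmetric adj;
  adj_irrefl : irreflexive adj }.

Definition nbr (G : sgraph) (v : G) : {set G} := [set w | adj v w].
Definition deg (G : sgraph) (v : G) : nat := #|nbr v|.

(* Nonempty sequences of layers with matching dimensions, and the composition
   of the maps computed by their layers: S n is the type of n-dimensional
   values on which the layers act. *)
Inductive chain (L : nat -> nat -> Type) (m n : nat) : Type :=
| Chain1 of L m n
| ChainS k of L m k & chain L k n.

Fixpoint chain_eval (L : nat -> nat -> Type) (S : nat -> Type)
    (ev : forall m n, L m n -> S m -> S n) m n (c : chain L m n) : S m -> S n :=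
  match c with
  | Chain1 l => ev m n l
  | ChainS k l c' => fun x => chain_eval ev c' (ev m k l x)
  end.

Fixpoint chain_all (L : nat -> nat -> Type) (P : forall m n, L m n -> Prop)
    m n (c : chain L m n) : Prop :=
  match c with
  | Chain1 l => P m n l
  | ChainS k l c' => P m k l /\ chain_all P c'
  end.

Variant activation := ReLU | Id.

Definition act_eval (R : realType) (a : activation) (x : R) : R :=
  match a with ReLU => Num.max x 0 | Id => x end.

Record fnn_layer (m n : nat) := FNNLayer {
  weight : 'M[rat]_(n, m);
  bias : 'cV[rat]_n;
  act : activation }.

Definition fnn_layer_eval (R : realType) m n (l : fnn_layer m n)
    (x : 'cV[R]_m) : 'cV[R]_n :=
  map_mx (act_eval (act l))
    (map_mx ratr (weight l) *m x + map_mx ratr (bias l)).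

Definition fnn : nat -> nat -> Type := chain fnn_layer.

Definition fnn_eval (R : realType) m n (N : fnn m n) : 'cV[R]_m -> 'cV[R]_n :=
  chain_eval (S := fun k => 'cV[R]_k) (@fnn_layer_eval R) N.

Variant aggregation := SUM | MEAN | MAX.

(* Multisets are represented by sequences; agg_eval_perm shows that the order
   of the elements is irrelevant. *)
Definition agg_eval (R : realType) (a : aggregation) r (s : seq 'cV[R]_r) :
    'cV[R]_r :=
  match a with
  | SUM => \sum_(x <- s) x
  | MEAN => (size s)%:R^-1 *: \sum_(x <- s) x
  | MAX => \col_i
      (if s is x0 :: _ then \big[Num.max/x0 i 0]_(x <- s) x i 0 else 0)
  end.

Lemma agg_eval_perm (R : realType) (a : aggregation) r (s t : seq 'cV[R]_r) :
  perm_eq s t -> agg_eval a s = agg_eval a t.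
Proof.
move=> st; case: a => /=.
- exact: perm_big.
- by rewrite (perm_size st); congr (_ *: _); apply: perm_big.
apply/colP => i; rewrite !mxE.
case: s t st => [|x s] [|y t] st //; try by have := perm_size st.
have H (u v : seq 'cV[R]_r) x0 y0 : perm_eq u v -> x0 \in u ->
    \big[Num.max/x0 i 0]_(z <- u) z i 0 <= \big[Num.max/y0 i 0]_(z <- v) z i 0.
  move=> uv x0u.
  have le z : z \in u -> z i 0 <= \big[Num.max/y0 i 0]_(z <- v) z i 0.
    by move=> zu; apply: (@le_bigmax_seq _ _ _ _ _ z xpredT
      (fun z : 'cV[R]_r => z i 0)) => //; rewrite -(perm_mem uv).
  by rewrite big_seq; apply: bigmax_le => [|z]; exact: le.
apply/le_anti/andP; split; apply: H; rewrite ?mem_head //.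
by rewrite perm_sym.
Qed.

Record gnn1_layer (p q : nat) := GNN1Layer {
  mdim1 : nat;
  msg1 : fnn p mdim1;
  agg1 : aggregation;
  comb1 : fnn (p + mdim1)%N q }.

Record gnn2_layer (p q : nat) := GNN2Layer {
  mdim2 : nat;
  msg2 : fnn (p + p)%N mdim2;
  agg2 : aggregation;
  comb2 : fnn (p + mdim2)%N q }.

Definition signal (R : realType) (G : sgraph) (l : nat) : Type := G -> 'cV[R]_l.

Definition gnn1_layer_eval (R : realType) (G : sgraph) p q
    (l : gnn1_layer p q) (f : signal R G p) : signal R G q := fun v =>
  fnn_eval (comb1 l)
    (col_mx (f v)
       (agg_eval (agg1 l) [seq fnn_eval (msg1 l) (f w) | w <- enum (nbr v)])).

Definition gnn2_layer_eval (R : realType) (G : sgraph) p q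
    (l : gnn2_layer p q) (f : signal R G p) : signal R G q := fun v =>
  fnn_eval (comb2 l)
    (col_mx (f v)
       (agg_eval (agg2 l)
          [seq fnn_eval (msg2 l) (col_mx (f v) (f w)) | w <- enum (nbr v)])).

Definition gnn1 : nat -> nat -> Type := chain gnn1_layer.
Definition gnn2 : nat -> nat -> Type := chain gnn2_layer.

Definition gnn1_eval (R : realType) (G : sgraph) p q (N : gnn1 p q) :
    signal R G p -> signal R G q :=
  chain_eval (S := signal R G) (@gnn1_layer_eval R G) N.

Definition gnn2_eval (R : realType) (G : sgraph) p q (N : gnn2 p q) :
    signal R G p -> signal R G q :=
  chain_eval (S := signal R G) (@gnn2_layer_eval R G) N.

Definition sum_gnn1 p q (N : gnn1 p q) : Prop :=
  chain_all (fun m n (l : gnn1_layer m n) => agg1 l = SUM) N.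

Definition sum_gnn2 p q (N : gnn2 p q) : Prop :=
  chain_all (fun m n (l : gnn2_layer m n) => agg2 l = SUM) N.

(* 'cV[R]_0 has exactly one element, the empty tuple. *)
Definition unlabelled (R : realType) (G : sgraph) : signal R G 0 := fun _ => 0.

Definition unary_query : Type := forall G : sgraph, {set G}.

Definition computes (R : realType) (S : forall G : sgraph, signal R G 1)
    (Q : unary_query) : Prop :=
  forall (G : sgraph) (v : G),
    (v \in Q G -> 3 / 4 <= S G v 0 0) /\ (v \notin Q G -> S G v 0 0 <= 1 / 4).

Definition gnn1_computes (R : realType) (N : gnn1 0 1) (Q : unary_query) : Prop :=
  computes (fun G => gnn1_eval N (@unlabelled R G)) Q.

Definition gnn2_computes (R : realType) (N : gnn2 0 1) (Q : unary_query) : Prop :=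
  computes (fun G => gnn2_eval N (@unlabelled R G)) Q.

Definition Q1 : unary_query := fun G =>
  [set u | [exists v in nbr u, (deg u < deg v)%N]].

(* Main.v *)
(** On the complete bipartite graph with sides of sizes [n] and [m], a SUM
    1-GNN gives all vertices of the first side, whose degree is [m], the same
    value [F m n], and all vertices of the other side the value [F n m].
    Aggregation replaces [F m n] by [m * F n m]. Hence, for large [m] and [n],
    [F] is a linear combination of the monomials
    [1, m, m n, m^2 n, m^2 n^2, ...]. Each of them dominates its predecessors
    as [min m n] tends to infinity, so that every ReLU eventually has constant
    sign and preserves this form. Such an [F] is either eventually constant or
    tends to plus or minus infinity, so it cannot separate [m < n] from
    [m = n].

    A 2-GNN sums [ReLU (deg w - deg v)] over the neighbours [w] of [v]. *)
Require Import Defs.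
From mathcomp Require Import all_boot all_order all_algebra.
From mathcomp Require Import reals.
Set Implicit Arguments.
Unset Strict Implicit.
Unset Printing Implicit Defensive.
Import Order.TTheory GRing.Theory Num.Theory.
Local Open Scope ring_scope.

(** * Growth of alternating polynomials in two variables *)

Section AlternatingPolynomials.
Variable R : realType.
Implicit Types (s t : seq R) (F : nat -> nat -> R).

(* Horner evaluation with the two variables swapped at each step:
   [s0 + m (s1 + n (s2 + m (s3 + ...)))]. *)
Fixpoint alt_eval s (m n : nat) : R :=
  if s is c :: s' then c + m%:R * alt_eval s' n m else 0.

(** A single threshold for both variables keeps the notion stable under exchanging them. *)
Definition ev_alt F := exists s N, forall m n,
  (N <= m)%N -> (N <= n)%N -> F m n = alt_eval s m n.

Definition to_pinfty F := forall B, exists N, forall m n,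
  (N <= m)%N -> (N <= n)%N -> B <= F m n.

Lemma alt_evalD s t : exists u, forall m n,
  alt_eval u m n = alt_eval s m n + alt_eval t m n.
Proof.
elim: s t => [|a s IHs] [|b t].
- by exists [::] => m n /=; rewrite addr0.
- by exists (b :: t) => m n; rewrite add0r.
- by exists (a :: s) => m n; rewrite addr0.
have [u uE] := IHs t; exists (a + b :: u) => m n /=.
by rewrite uE mulrDr addrACA.
Qed.

Lemma alt_evalZ a s m n :
  alt_eval [seq a * c | c <- s] m n = a * alt_eval s m n.
Proof.
by elim: s m n => [|c s IHs] m n /=; rewrite ?mulr0 // IHs mulrDr mulrCA.
Qed.

(** Once [m >= (B - a) / c], the product is at least [B - a]. An eventual positive lower bound holds
    both for a positive constant tail and for a tail tending to infinity. *)
Lemma to_pinfty_step a F c : 0 < c ->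
  (exists N, forall m n, (N <= m)%N -> (N <= n)%N -> c <= F m n) ->
  to_pinfty (fun m n => a + m%:R * F n m).
Proof.
move=> c0 [N FN] B; pose K := Num.Def.archi_bound `|(B - a) / c|.
exists (maxn N K) => m n; rewrite !geq_max => /andP[Nm Km] /andP[Nn _].
rewrite -lerBlDl; apply: (@le_trans _ _ (m%:R * c)); last first.
  by rewrite ler_wpM2l // FN.
rewrite -ler_pdivrMr //; apply: le_trans (ler_norm _) _.
apply: le_trans (ltW (archi_boundP (normr_ge0 _))) _.
by rewrite ler_nat.
Qed.

Lemma to_pinftyN_step a F c : 0 < c ->
  (exists N, forall m n, (N <= m)%N -> (N <= n)%N -> c <= - F m n) ->
  to_pinfty (fun m n => - (a + m%:R * F n m)).
Proof.
move=> c0 FN B.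
have [N aF] := @to_pinfty_step (- a) (fun m n => - F m n) c c0 FN B.
by exists N => m n Nm Nn; rewrite opprD -mulrN; apply: aF.
Qed.

(** The sign of the last nonzero coefficient decides, unless that coefficient is the constant term;
    multiplying by [m] keeps the sign of a nonzero tail and makes it unbounded. *)
Lemma alt_eval_trichotomy s :
  [\/ exists c, forall m n, alt_eval s m n = c,
      to_pinfty (alt_eval s) | to_pinfty (fun m n => - alt_eval s m n)].
Proof.
elim: s => [|a s [[c sE]|s_pos|s_neg]]; first by constructor 1; exists 0.
- have [c_lt0|c_gt0|c0] := ltgtP c 0.
  + constructor 3.
    apply: (@to_pinftyN_step a (alt_eval s) (- c)); rewrite ?oppr_gt0 //.
    by exists 0%N => m n _ _; rewrite sE.
  + constructor 2; apply: (@to_pinfty_step a (alt_eval s) _ c_gt0).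
    by exists 0%N => m n _ _; rewrite sE.
  + by constructor 1; exists a => m n /=; rewrite sE c0 mulr0 addr0.
- by constructor 2; apply: (@to_pinfty_step a (alt_eval s) _ ltr01 (s_pos 1)).
- by constructor 3; apply: (@to_pinftyN_step a (alt_eval s) _ ltr01 (s_neg 1)).
Qed.

Lemma eq_ev_alt F1 F2 :
  (forall m n, F1 m n = F2 m n) -> ev_alt F1 -> ev_alt F2.
Proof. by move=> E [s [N sN]]; exists s, N => m n ? ?; rewrite -E sN. Qed.

Lemma ev_alt_const c : ev_alt (fun _ _ => c).
Proof. by exists [:: c], 0%N => m n _ _ /=; rewrite mulr0 addr0. Qed.

Lemma ev_altD F1 F2 :
  ev_alt F1 -> ev_alt F2 -> ev_alt (fun m n => F1 m n + F2 m n).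
Proof.
move=> [s1 [N1 E1]] [s2 [N2 E2]]; have [u uE] := alt_evalD s1 s2.
exists u, (maxn N1 N2) => m n; rewrite !geq_max => /andP[? ?] /andP[? ?].
by rewrite uE E1 // E2.
Qed.

Lemma ev_altZ a F : ev_alt F -> ev_alt (fun m n => a * F m n).
Proof.
move=> [s [N E]]; exists [seq a * c | c <- s], N => m n ? ?.
by rewrite alt_evalZ E.
Qed.

Lemma ev_alt_sum (I : Type) (r : seq I) (F : I -> nat -> nat -> R) :
  (forall i, ev_alt (F i)) -> ev_alt (fun m n => \sum_(i <- r) F i m n).
Proof.
move=> altF; elim: r => [|i r IHr].
  by apply: eq_ev_alt (ev_alt_const 0) => m n; rewrite big_nil.
by apply: eq_ev_alt (ev_altD (altF i) IHr) => m n; rewrite big_cons.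
Qed.

Lemma ev_alt_swap F : ev_alt F -> ev_alt (fun m n => m%:R * F n m).
Proof.
by move=> [s [N E]]; exists (0 :: s), N => m n ? ? /=; rewrite add0r E.
Qed.

(** By the trichotomy, ReLU acts on a constant, or is eventually the identity, or is eventually
    zero. *)
Lemma ev_alt_act a F : ev_alt F -> ev_alt (fun m n => act_eval a (F m n)).
Proof.
case: a => //= -[s [N E]]; have [[c sE]|/(_ 0) [K sK]|/(_ 0) [K sK]] :=
  alt_eval_trichotomy s.
- exists [:: Num.max c 0], N => m n ? ?.
  by rewrite E // sE /= mulr0 addr0.
- exists s, (maxn N K) => m n; rewrite !geq_max => /andP[? ?] /andP[? ?].
  by rewrite E //; apply/max_idPl/sK.
- exists [::], (maxn N K) => m n; rewrite !geq_max => /andP[? ?] /andP[? ?].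
  by rewrite E //; apply/max_idPr; rewrite -oppr_ge0 sK.
Qed.

Lemma ev_alt_nonseparating F : ev_alt F -> exists m n,
  [/\ (0 < m)%N, (m < n)%N & ~ (3 / 4 <= F m n /\ F m m <= 1 / 4)].
Proof.
have lt_14_34 : 1 / 4 < 3 / 4 :> R.
  by rewrite ltr_pM2r ?invr_gt0 ?ltr0n // ltr1n.
move=> [s [N E]].
suff [M sM] : exists M, forall K, (M <= K)%N ->
    ~ (3 / 4 <= alt_eval s K K.+1 /\ alt_eval s K K <= 1 / 4).
  have [NK MK] := (leq_maxl N M, leq_maxr N M).
  (* The extra successor makes [m] positive, so that both sides of the graphs will be nonempty. *)
  exists (maxn N M).+1, (maxn N M).+2; split=> //.
  by rewrite !E; [apply: sM | ..]; rewrite !leqW.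
have [[c sE]|/(_ (3 / 4)) [M sM]|/(_ 0) [M sM]] := alt_eval_trichotomy s.
- exists 0%N => K _ []; rewrite !sE => gec lec.
  by have := le_trans gec lec; rewrite leNgt lt_14_34.
- exists M => K MK [_]; apply/negP; rewrite -ltNge.
  exact: lt_le_trans lt_14_34 (sM _ _ MK MK).
- exists M => K MK [+ _]; apply/negP; rewrite -ltNge.
  have := sM K K.+1 MK (leqW MK); rewrite oppr_ge0 => /le_lt_trans; apply.
  by rewrite divr_gt0 ?ltr0n.
Qed.

Definition ev_alt_vec p (X : nat -> nat -> 'cV[R]_p) :=
  forall i, ev_alt (fun m n => X m n i 0).

Lemma ev_alt_fnn p q (N : fnn p q) X :
  ev_alt_vec X -> ev_alt_vec (fun m n => fnn_eval N (X m n)).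
Proof.
have layer p' q' (l : fnn_layer p' q') Y :
    ev_alt_vec Y -> ev_alt_vec (fun m n => fnn_layer_eval l (Y m n)).
  move=> altY i; pose F m n :=
    \sum_j ratr (weight l i j) * Y m n j 0 + ratr (bias l i 0).
  have altF : ev_alt F.
    apply: ev_altD (ev_alt_const _).
    by apply: ev_alt_sum => j; apply: ev_altZ.
  apply: eq_ev_alt (ev_alt_act (act l) altF) => m n; rewrite !mxE.
  by congr (act_eval _ (_ + _)); apply: eq_bigr => j _; rewrite mxE.
elim: N X => [p' q' l|p' q' k l N IHN] X altX; first exact: layer.
by apply: IHN; apply: layer.
Qed.

End AlternatingPolynomials.

(** * Complete bipartite graphs *)

Section CompleteBipartite.
Variables a b : nat.

Definition bip_adj (x y : 'I_a + 'I_b) : bool := is_inl x != is_inl y.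

Lemma bip_adj_sym : symmetric bip_adj.
Proof. by move=> x y; rewrite /bip_adj eq_sym. Qed.

Lemma bip_adj_irrefl : irreflexive bip_adj.
Proof. by move=> x; rewrite /bip_adj eqxx. Qed.

Definition bipartite : sgraph := SGraph bip_adj_sym bip_adj_irrefl.

Lemma deg_bipartite (v : bipartite) : deg v = if v is inl _ then b else a.
Proof.
rewrite /deg cardsE; case: v => v.
- rewrite -[RHS]card_ord -(card_image (@inr_inj 'I_a 'I_b)).
  apply: eq_card => -[w|w]; rewrite unfold_in /= ?image_f //.
  by apply/esym/imageP => -[].
- rewrite -[RHS]card_ord -(card_image (@inl_inj 'I_a 'I_b)).
  apply: eq_card => -[w|w]; rewrite unfold_in /= ?image_f //.
  by apply/esym/imageP => -[].
Qed.

(** The first argument of [X] is the degree of the vertex, the second the size of its own side. *)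
Definition bip_signal (R : realType) p (X : nat -> nat -> 'cV[R]_p) :
    signal R bipartite p :=
  fun v => if v is inl _ then X b a else X a b.

End CompleteBipartite.

(** * SUM 1-GNNs on complete bipartite graphs *)

Definition sum_step (R : realType) p q (l : gnn1_layer p q)
    (X : nat -> nat -> 'cV[R]_p) m n : 'cV[R]_q :=
  fnn_eval (comb1 l) (col_mx (X m n) (m%:R *: fnn_eval (msg1 l) (X n m))).

Lemma ev_alt_sum_step (R : realType) p q (l : gnn1_layer p q)
    (X : nat -> nat -> 'cV[R]_p) :
  ev_alt_vec X -> ev_alt_vec (sum_step l X).
Proof.
move=> altX; apply: ev_alt_fnn => i; case: (split_ordP i) => j ->.
  by apply: eq_ev_alt (altX j) => m n; rewrite col_mxEu.
apply: eq_ev_alt (ev_alt_swap (ev_alt_fnn (msg1 l) altX j)) => m n.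
by rewrite col_mxEd mxE.
Qed.

(** All neighbours of [v] lie on the opposite side and send the same message, so the sum is [deg v]
    times that message. *)
Lemma sum_layer_bipartite (R : realType) a b p q (l : gnn1_layer p q)
    (X : nat -> nat -> 'cV[R]_p) (f : signal R (bipartite a b) p) :
  agg1 l = SUM -> f =1 bip_signal X ->
  gnn1_layer_eval l f =1 bip_signal (sum_step l X).
Proof.
move=> lsum fX v; rewrite /gnn1_layer_eval lsum /= big_map big_enum /=.
rewrite (eq_bigr (fun=> fnn_eval (msg1 l)
  (if v is inl _ then X a b else X b a))); last first.
  by move=> w; rewrite inE fX; case: v w => v [w|w].
by rewrite sumr_const -/(deg v) deg_bipartite fX -scaler_nat; case: v.
Qed.

(** [Y] is chosen before [a] and [b]: one function describes the output on all these graphs, which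
    permits comparing two of them. *)
Lemma sum_gnn1_bipartite (R : realType) p q (N : gnn1 p q)
    (X : nat -> nat -> 'cV[R]_p) :
  sum_gnn1 N -> ev_alt_vec X ->
  exists2 Y : nat -> nat -> 'cV[R]_q, ev_alt_vec Y &
    forall a b (f : signal R (bipartite a b) p), f =1 bip_signal X ->
      gnn1_eval N f =1 bip_signal Y.
Proof.
elim: N X => [p' q' l|p' q' k l N IHN] X /= => [lsum|[lsum Nsum]] altX.
  exists (sum_step l X) => [|a b f fX]; first exact: ev_alt_sum_step.
  exact: sum_layer_bipartite.
have [Y altY NY] := IHN _ Nsum (ev_alt_sum_step l altX).
by exists Y => // a b f fX; apply: NY; apply: sum_layer_bipartite.
Qed.

Lemma sum_gnn1_not_Q1 (R : realType) (N : gnn1 0 1) :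
  sum_gnn1 N -> ~ gnn1_computes R N Q1.
Proof.
move=> Nsum NQ1.
have [|Y altY NY] := @sum_gnn1_bipartite R _ _ N (fun _ _ => 0) Nsum.
  by case.
have [m [n [m_gt0 ltmn]]] := ev_alt_nonseparating (altY 0); apply.
have n_gt0 := ltn_trans m_gt0 ltmn.
have EN a b v : gnn1_eval N (@unlabelled R (bipartite a b)) v = bip_signal Y v.
  by apply: NY => -[].
split.
(* Vertices on the side of size [n] have degree [m < n], their neighbours degree [n]; the output is
   [Y m n]. *)
- have [+ _] := NQ1 (bipartite n m) (inl (Ordinal n_gt0)).
  rewrite EN /=; apply; rewrite inE; apply/existsP.
  exists (inr (Ordinal m_gt0)).
  by rewrite inE !deg_bipartite.
(* This graph is regular, so the query is empty; the output is [Y m m]. *)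
- have [_] := NQ1 (bipartite m m) (inl (Ordinal m_gt0)).
  rewrite EN /=; apply; rewrite inE; apply/existsPn => v.
  by rewrite !deg_bipartite; case: v => v; rewrite ltnn andbF.
Qed.

(** * A SUM 2-GNN for the query *)

Definition degree_layer : gnn2_layer 0 1 :=
  GNN2Layer (Chain1 (FNNLayer 0 (const_mx 1) Id)) SUM
    (Chain1 (FNNLayer (row_mx 0 1%:M) 0 Id)).

Definition excess_layer : gnn2_layer 1 1 :=
  GNN2Layer (Chain1 (FNNLayer (row_mx (- 1%:M) 1%:M) 0 ReLU)) SUM
    (Chain1 (FNNLayer (row_mx 0 1%:M) 0 Id)).

Definition Q1_gnn2 : gnn2 0 1 := ChainS degree_layer (Chain1 excess_layer).

Lemma fnn_project_eval (R : realType) p q (x : 'cV[R]_p) (y : 'cV[R]_q) :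
  fnn_layer_eval (FNNLayer (row_mx 0 1%:M) 0 Id) (col_mx x y) = y.
Proof.
rewrite /fnn_layer_eval /= map_row_mx map_mx0 map_mx1 map_mx0 addr0.
by rewrite mul_row_col mul0mx mul1mx add0r; apply/matrixP => i j; rewrite mxE.
Qed.

Lemma degree_layer_eval (R : realType) (G : sgraph) (f : signal R G 0) v :
  gnn2_layer_eval degree_layer f v 0 0 = (deg v)%:R.
Proof.
rewrite /gnn2_layer_eval /fnn_eval /= fnn_project_eval big_map big_enum /=.
rewrite summxE (eq_bigr (fun=> 1)) ?sumr_const // => w _.
by rewrite /fnn_layer_eval /= map_mx0 mul0mx add0r !mxE rmorph1.
Qed.

Lemma excess_layer_eval (R : realType) (G : sgraph) (f : signal R G 1) v :
  gnn2_layer_eval excess_layer f v 0 0 =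
  \sum_(w in nbr v) Num.max (f w 0 0 - f v 0 0) 0.
Proof.
rewrite /gnn2_layer_eval /fnn_eval /= fnn_project_eval big_map big_enum /=.
rewrite summxE; apply: eq_bigr => w _.
rewrite /fnn_layer_eval /= map_mx0 addr0 map_row_mx map_mxN map_mx1.
by rewrite mul_row_col mulNmx !mul1mx !mxE addrC.
Qed.

Lemma Q1_gnn2_computes (R : realType) : gnn2_computes R Q1_gnn2 Q1.
Proof.
move=> G v; rewrite /gnn2_eval /= excess_layer_eval.
under eq_bigr do rewrite !degree_layer_eval.
split=> [|vQ].
- rewrite inE => /existsP[w /andP[vw ltvw]].
  (* Degrees are integers, so the term of [w] alone is at least 1. *)
  rewrite (bigD1 w) //=; apply: (@le_trans _ _ 1).
    by rewrite ler_pdivrMr ?ltr0n // mul1r ler_nat.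
  apply: ler_wpDr; first by apply: sumr_ge0 => u _; rewrite le_max lexx orbT.
  by rewrite le_max -natrB ?(ltnW ltvw) // ler1n subn_gt0 ltvw.
- rewrite big1 ?divr_ge0 // => w vw; apply/max_idPr.
  rewrite subr_le0 ler_nat leqNgt; apply: contra vQ => ltvw.
  by rewrite inE; apply/existsP; exists w; rewrite vw.
Qed.

Theorem theorem5p1 (R : realType) :
  (exists N : gnn2 0 1, sum_gnn2 N /\ gnn2_computes R N Q1) /\
  ~ (exists N : gnn1 0 1, sum_gnn1 N /\ gnn1_computes R N Q1).
Proof.
split; first by exists Q1_gnn2; split=> //; apply: Q1_gnn2_computes.
by move=> [N [Nsum]]; apply: sum_gnn1_not_Q1.
Qed.
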